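(* Let $X$ and $Y$ be path-connected spaces and let $n\ge 2$ be an integer. If $(X\times Y)^n$ is normal, then $$\operatorname{TC}_n(X\times Y)\le \operatorname{TC}_n(X)+\operatorname{TC}_n(Y).$$
   Context: A normal space is, by convention, required to be Hausdorff. All numerical invariants may take the value $\infty$. The Schwarz genus of a map $p:E\to B$ is the least $k$ such that there is an open cover $U_0,\ldots,U_k$ of $B$ and, for each $i$, a continuous map $s_i:U_i\to E$ with $p s_i$ homotopic to the inclusion $U_i\hookrightarrow B$. For a fibration this is equivalent to requiring honest local sections. Let $J_n$ be the wedge of $n$ copies of $[0,1]$, each with base point $0$, and let $1_i$ denote the point $1$ in the $i$-th copy. $\operatorname{TC}_n(X)$, the $n$-th topological complexity of a path-connected space $X$, is the Schwarz genus of the fibration $e_n:X^{J_n}\to X^n$, $e_n(\gamma)=(\gamma(1_1),\ldots,\gamma(1_n))$, where $X^{J_n}$ is the space of continuous maps $J_n\to X$ with the compact-open topology. *)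

(* Defs.v *)
From HB Require Import structures.
From mathcomp Require Import all_boot all_order all_algebra.
From mathcomp Require Import all_classical all_reals all_analysis.
From mathcomp Require Import wedge_sigT.

Set Implicit Arguments.
Unset Strict Implicit.
Unset Printing Implicit Defensive.

Import Order.TTheory GRing.Theory Num.Theory.
Import numFieldNormedType.Exports.

Local Open Scope classical_set_scope.
Local Open Scope ring_scope.

Section UnitInterval.
Variable R : realType.

Definition unit_interval : Type := set_type (`[0, 1]%classic : set R).

HB.instance Definition _ :=
  Topological.copy unit_interval (set_type (`[0, 1]%classic : set R)).

Lemma unit_interval0_subproof : (0 : R) \in (`[0, 1]%classic : set R).
Proof. by rewrite inE /= in_itv /= lexx ler01. Qed.

Lemma unit_interval1_subproof : (1 : R) \in (`[0, 1]%classic : set R).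
Proof. by rewrite inE /= in_itv /= lexx ler01. Qed.

Definition unit_interval0 : unit_interval := exist _ 0 unit_interval0_subproof.
Definition unit_interval1 : unit_interval := exist _ 1 unit_interval1_subproof.

Lemma unit_interval01_subproof : unit_interval0 != unit_interval1.
Proof. by apply/eqP => -[/eqP]; rewrite eq_sym oner_eq0. Qed.

HB.instance Definition _ := isBiPointed.Build unit_interval
  unit_interval01_subproof.

End UnitInterval.

Definition path_connected_space (R : realType) (X : topologicalType) : Prop :=
  forall x y : X, exists f : unit_interval R -> X,
    [/\ continuous f, f zero = x & f one = y].

Definition homotopic (R : realType) (A B : topologicalType) (f g : A -> B) :
    Prop :=
  exists H : A * unit_interval R -> B,
    [/\ continuous H, (forall a, H (a, zero) = f a)
      & (forall a, H (a, one) = g a)].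

(* A set [U : set B] coerces to the type [set_type U], whose topology is the
   subspace topology and whose inclusion into [B] is [set_val]. *)
Definition has_homotopy_section_cover (R : realType) (E B : topologicalType)
    (p : E -> B) (k : nat) : Prop :=
  exists U : 'I_k.+1 -> set B,
    [/\ forall i, open (U i), \bigcup_i U i = [set: B]
      & forall i, exists2 s : U i -> E,
          continuous s & homotopic R (p \o s) (set_val : U i -> B)].

(* An infimum of natural numbers in [\bar R]: the least such [k] if there is
   one, and [+oo] otherwise. *)
Definition schwarz_genus (R : realType) (E B : topologicalType) (p : E -> B) :
    \bar R :=
  ereal_inf [set k%:R%:E | k in has_homotopy_section_cover R p].

Section TopologicalComplexity.
Variables (R : realType) (n : nat).

Definition star : topologicalType :=
  wedge (fun _ : 'I_n => zero : unit_interval R).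

Definition star_end (i : 'I_n) : star :=
  @wedge_lift 'I_n (fun=> unit_interval R) (fun=> zero) i one.

Variable X : topologicalType.

Definition star_maps : Type := continuousType star X.

HB.instance Definition _ := Choice.on star_maps.

(* The subspace topology induced by the compact-open topology on all maps. *)
HB.instance Definition _ := Topological.copy star_maps
  (initial_topology (id : continuousType star X -> {compact-open, star -> X})).

Definition star_eval (gamma : star_maps) : {ptws 'I_n -> X} :=
  fun i => (gamma : continuousType star X) (star_end i).

Definition TC : \bar R := schwarz_genus R star_eval.

End TopologicalComplexity.

(* Main.v *)
(* Let U_0, ..., U_k and V_0, ..., V_l be open covers of X^n and Y^n carrying
   sections, pulled back to the normal space Z = (X x Y)^n. By Urysohn there are
   functions f_i, g_j supported in U_i, V_j such that at every point some f_i and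
   some g_j exceed 1/2. Put p_i = max(0, f_0, ..., f_(i-1)) and
   q_j = max(0, g_0, ..., g_(j-1)). For each z in Z these cut the half-line into
   the intervals (p_i, p_(i+1)), nonempty only if z lies in U_i, and
   (q_j, q_(j+1)), nonempty only if z lies in V_j. Let W_ij be the open set of
   the z for which the i-th and the j-th interval overlap. The pairs (i, j) of
   overlapping intervals form a staircase, so the W_ij with i + j = m are pairwise
   disjoint, and the sections over U_i and V_j glue to a section over their union.
   The k + l + 1 unions obtained for m = 0, ..., k + l cover Z. *)
Require Import Defs.
From HB Require Import structures.
From mathcomp Require Import all_boot all_order all_algebra.
From mathcomp Require Import all_classical all_reals all_analysis.
From mathcomp Require Import wedge_sigT.

Set Implicit Arguments.
Unset Strict Implicit.
Unset Printing Implicit Defensive.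

Import Order.TTheory GRing.Theory Num.Theory.
Import numFieldNormedType.Exports.

Local Open Scope classical_set_scope.
Local Open Scope ring_scope.

(** * Continuity, compactness and subset types *)

Section Topology.
Implicit Types A B C : topologicalType.

Lemma set_val_continuous A (U : set A) : continuous (set_val : U -> A).
Proof. exact: initial_continuous. Qed.

Lemma continuous_fun_pair A B C (f : A -> B) (g : A -> C) :
  continuous f -> continuous g -> continuous (fun a => (f a, g a)).
Proof. by move=> cf cg a; apply: cvg_pair; [exact: cf|exact: cg]. Qed.

Lemma continuous_pair_cst A B (b : B) : continuous (fun a : A => (a, b)).
Proof. by move=> a; apply: cvg_pair; [exact: cvg_id|exact: cvg_cst]. Qed.

Lemma fst_continuous A B : continuous (@fst A B).
Proof. by move=> z; exact: cvg_fst. Qed.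

Lemma snd_continuous A B : continuous (@snd A B).
Proof. by move=> z; exact: cvg_snd. Qed.

Lemma continuous_compT A B C (f : A -> B) (g : B -> C) :
  continuous f -> continuous g -> continuous (g \o f).
Proof. by move=> cf cg a; apply: continuous_comp; [exact: cf|exact: cg]. Qed.

(** The pointwise topology is the supremum of the topologies induced by the coordinate
    projections. *)
Lemma continuous_prodP (I : eqType) A B (f : A -> {ptws I -> B}) :
  continuous f <-> forall i, continuous (fun a => f a i).
Proof.
split=> [cf i|cf a].
  by apply: (@continuous_compT _ _ _ f (proj i)) => //; exact: proj_continuous.
apply/cvg_sup => i.
apply: (@continuous_comp_initial _ _ _ (@proj I (fun=> B) i) f) => //.
exact: cf.
Qed.

Definition corestrict A B (f : A -> B) (U : set B) (fU : forall a, U (f a))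
    (a : A) : U :=
  SigSub (mem_set (fU a)).

Lemma corestrict_continuous A B (f : A -> B) (U : set B)
    (fU : forall a, U (f a)) :
  continuous f -> continuous (corestrict fU).
Proof. by move=> cf; apply: continuous_comp_initial. Qed.

(** Continuity of [f \o set_val] is continuity of [f] on the subspace [V], and for open [V] this is
    ordinary continuity at the points of [V]. *)
Lemma continuous_local A B (f : A -> B) :
  (forall a, exists V : set A,
    [/\ open V, V a & continuous (f \o set_val : V -> B)]) -> continuous f.
Proof.
move=> loc a; have [V [oV Va cfV]] := loc a.
have /subspace_sigL_continuousP : continuous (sigL V f) by [].
by rewrite continuous_open_subspace// => /(_ a); apply; exact/mem_set.
Qed.

(** A filter on the type [K] is pushed forward to [A]; a cluster point found in [K] also clusters
    the original filter, as open sets of [K] are traces of open sets of [A]. *)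
Lemma compact_set_type A (K : set A) : compact K -> compact [set: K].
Proof.
move=> cK F PF _.
have [|p [Kp Fp]] := cK (set_val @ F) _.
  by apply: (@filterS _ F _ setT) filterT => x _; exact: set_valP.
exists (SigSub (mem_set Kp)); split=> // P Q FP [W [[G oG <-] Gp GQ]].
have [|y [[x Px <-] Gy]] := Fp (set_val @` P) G _ (open_nbhs_nbhs (conj oG Gp)).
  by apply: (@filterS _ F _ P) FP => x Px; exists x.
by exists x; split=> //; exact: GQ.
Qed.

Lemma hausdorff_set_type A (K : set A) :
  hausdorff_space A -> hausdorff_space (set_type K).
Proof.
move=> hA x y xy; apply/val_inj/hA => P Q nP nQ.
have [z [Pz Qz]] := xy _ _ (set_val_continuous nP) (set_val_continuous nQ).
by exists (val z).
Qed.

Lemma compact_locally_compact A : compact [set: A] -> locally_compact [set: A].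
Proof.
move=> cA a _; exists setT; first by rewrite withinET; exact: filterT.
by split=> //; exact: closedT.
Qed.

End Topology.

(** * Evaluation and pairing of maps on the star *)

Section Star.
Variables (R : realType) (n : nat).

Lemma star_compact : compact [set: star R n].
Proof.
apply: wedge_compact => [|_]; first exact: finite_finset.
exact/compact_set_type/segment_compact.
Qed.

Lemma star_hausdorff : hausdorff_space (star R n).
Proof. apply: wedge_hausdorff => _; exact/hausdorff_set_type/Rhausdorff. Qed.

(** Evaluation is the uncurried inclusion into the compact-open space; uncurrying preserves
    continuity because the star is compact Hausdorff, hence locally compact. *)
Lemma star_app_continuous (X : topologicalType) :
  continuous (fun g : star_maps R n X * star R n =>
    (g.1 : continuousType (star R n) X) g.2).
Proof.
rewrite [X in continuous X](_ :
  _ = uncurry (id : star_maps R n X -> {compact-open, star R n -> X}));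
  last by apply/funext => -[].
apply: continuous_uncurry => [|||g].
- exact/compact_locally_compact/star_compact.
- exact: star_hausdorff.
- exact: initial_continuous.
- exact: cts_fun.
Qed.

Section Pair.
Variables X Y : topologicalType.

Definition star_pair (g : star_maps R n X * star_maps R n Y) :
    star_maps R n (X * Y)%type :=
  mkcts (continuous_fun_pair (@cts_fun _ _ (g.1 : continuousType _ _))
    (@cts_fun _ _ (g.2 : continuousType _ _))).

(** A map into a compact-open space is continuous once its uncurried form is; here that form sends
    [((g, h), t)] to [(g t, h t)] and is built from two evaluations. *)
Lemma star_pair_continuous : continuous star_pair.
Proof.
apply: continuous_comp_initial.
pose MXY := (star_maps R n X * star_maps R n Y * star R n)%type.
have c1 : continuous (fst : MXY -> _) by exact: fst_continuous.
have c2 : continuous (snd : MXY -> _) by exact: snd_continuous.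
pose eX (z : MXY) := (z.1.1, z.2); pose eY (z : MXY) := (z.1.2, z.2).
have ceX : continuous eX.
  apply: continuous_fun_pair => //.
  exact: continuous_compT (@fst_continuous _ _).
have ceY : continuous eY.
  apply: continuous_fun_pair => //.
  exact: continuous_compT (@snd_continuous _ _).
apply: continuous_curry_fun (continuous_fun_pair
  (continuous_compT ceX (@star_app_continuous X))
  (continuous_compT ceY (@star_app_continuous Y))).
Qed.

End Pair.
End Star.

(** * Gluing homotopy sections over disjoint open sets *)

Definition has_homotopy_section (R : realType) (E B : topologicalType)
    (p : E -> B) (U : set B) : Prop :=
  exists2 s : U -> E,
    continuous s & homotopic R (p \o s) (set_val : U -> B).

Section Glue.
Variables (R : realType) (E B : topologicalType) (p : E -> B).
Variables (I : Type) (W : I -> set B).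
Hypothesis W_open : forall i, open (W i).
Hypothesis W_disjoint : forall i j z, W i z -> W j z -> i = j.

(* The parameter space [C] lets one lemma glue both sections and homotopies. *)
Lemma continuous_glue (C D : topologicalType)
    (f : (\bigcup_i W i)%classic * C -> D) (g : forall i, W i * C -> D) :
  (forall i, continuous (g i)) ->
  (forall i z (Wz : W i (set_val z)) c,
    f (z, c) = g i (SigSub (mem_set Wz), c)) ->
  continuous f.
Proof.
move=> cg fg; apply: continuous_local => -[z c].
have [i _ Wz] := set_valP z.
pose pt (x : (\bigcup_i W i)%classic * C) := set_val x.1.
have cpt : continuous pt.
  exact: continuous_compT (@fst_continuous _ _) (@set_val_continuous _ _).
pose V := pt @^-1` W i.
exists V; split=> //; first by apply: open_comp => // ? _; exact: cpt.
have VW (v : V) : W i (pt (set_val v)) by exact: (set_valP v).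
have cV := @set_val_continuous _ V.
rewrite (_ : _ \o _ = g i \o (fun v => (corestrict VW v, (set_val v).2))).
  apply: continuous_compT (cg i); apply: continuous_fun_pair.
    by apply: corestrict_continuous; exact: continuous_compT cV cpt.
  exact: continuous_compT cV (@snd_continuous _ _).
by apply/funext => -[[y d] Vy]; exact: (fg i y (VW (SigSub Vy))).
Qed.

Lemma has_homotopy_section_bigcup :
  (forall i, has_homotopy_section R p (W i)) ->
  has_homotopy_section R p (\bigcup_i W i).
Proof.
move=> secW.
pose s i := projT1 (cid2 (secW i)).
have cs i : continuous (s i) by rewrite /s; case: cid2.
have hs i : homotopic R (p \o s i) (set_val : W i -> B).
  by rewrite /s; case: cid2.
pose H i := projT1 (cid (hs i)).
have [cH H0 H1] : [/\ forall i, continuous (H i),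
    forall i w, H i (w, zero) = p (s i w) &
    forall i w, H i (w, one) = set_val w].
  by split=> i; rewrite /H; case: cid => h [].
pose idx (z : (\bigcup_i W i)%classic) := projT1 (cid2 (set_valP z)).
have idxP z : W (idx z) (set_val z) by rewrite /idx; case: cid2.
pose ret z : W (idx z) := SigSub (mem_set (idxP z)).
(* Disjointness identifies the chosen index with any [i] such that [W i] contains the point, so
   nothing depends on the choice. *)
have retE T (g : forall i, W i -> T) i z (Wz : W i (set_val z)) :
    g (idx z) (ret z) = g i (SigSub (mem_set Wz)).
  have e := W_disjoint (idxP z) Wz.
  rewrite /ret; move: (idxP z); rewrite e => Wz'.
  by congr (g i _); exact: val_inj.
exists (fun z => s (idx z) (ret z)).
  (* The section needs no parameter: it is glued with the unit interval as a dummy factor and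
     restricted to time [zero]. *)
  pose f (zt : (\bigcup_i W i)%classic * unit_interval R) :=
    s (idx zt.1) (ret zt.1).
  apply: (@continuous_compT _ _ _ (fun z => (z, zero)) f).
    exact: continuous_pair_cst.
  apply: (continuous_glue (g := fun i => s i \o fst)) => [i|i z Wz c].
    exact: continuous_compT (@fst_continuous _ _) (cs i).
  exact: retE s i z Wz.
exists (fun zt => H (idx zt.1) (ret zt.1, zt.2)); split.
- apply: (continuous_glue cH) => i z Wz c.
  exact: (retE _ (fun i w => H i (w, c))).
- by move=> z; rewrite H0.
- by move=> z; rewrite H1.
Qed.

End Glue.

(** * Homotopy sections for a product of two spaces *)

Section Product.
Variables (R : realType) (n : nat) (X Y : topologicalType).

(** The sections are pulled back along the two projections and paired pointwise on the star; the two
    homotopies run simultaneously, one in each factor. *)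
Lemma has_homotopy_section_prod
    (U : set {ptws 'I_n -> X}) (V : set {ptws 'I_n -> Y})
    (W : set {ptws 'I_n -> (X * Y)%type}) :
  (forall w, W w -> U (fun i => (w i).1)) ->
  (forall w, W w -> V (fun i => (w i).2)) ->
  has_homotopy_section R (@star_eval R n X) U ->
  has_homotopy_section R (@star_eval R n Y) V ->
  has_homotopy_section R (@star_eval R n (X * Y)%type) W.
Proof.
move=> WU WV [s cs [H [cH H0 H1]]] [t ct [K [cK K0 K1]]].
pose fX (w : W) : {ptws 'I_n -> X} :=
  fun i => ((set_val w : {ptws 'I_n -> (X * Y)%type}) i).1.
pose fY (w : W) : {ptws 'I_n -> Y} :=
  fun i => ((set_val w : {ptws 'I_n -> (X * Y)%type}) i).2.
pose rU := corestrict ((fun w => WU _ (set_valP w)) : forall w, U (fX w)).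
pose rV := corestrict ((fun w => WV _ (set_valP w)) : forall w, V (fY w)).
have cW i :
    continuous (fun w : W => (set_val w : {ptws 'I_n -> (X * Y)%type}) i).
  exact: (iffLR (continuous_prodP _) (@set_val_continuous _ W)).
have cU : continuous rU.
  apply/corestrict_continuous/continuous_prodP => i.
  exact: continuous_compT (cW i) (@fst_continuous _ _).
have cV : continuous rV.
  apply/corestrict_continuous/continuous_prodP => i.
  exact: continuous_compT (cW i) (@snd_continuous _ _).
exists (fun w => star_pair (s (rU w), t (rV w))).
  apply: (@continuous_compT _ _ _ (fun w => (s (rU w), t (rV w)))).
    by apply: continuous_fun_pair; [exact: continuous_compT cU cs|
      exact: continuous_compT cV ct].
  exact: star_pair_continuous.
exists (fun wt => fun i => (H (rU wt.1, wt.2) i, K (rV wt.1, wt.2) i)); split.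
- apply/continuous_prodP => i; apply: continuous_fun_pair.
  + apply: (@continuous_compT _ _ _ (fun wt => (rU wt.1, wt.2)) (H ^~ i)).
      apply: continuous_fun_pair; last exact: snd_continuous.
      exact: continuous_compT (@fst_continuous _ _) cU.
    by move: i; apply/continuous_prodP.
  + apply: (@continuous_compT _ _ _ (fun wt => (rV wt.1, wt.2)) (K ^~ i)).
      apply: continuous_fun_pair; last exact: snd_continuous.
      exact: continuous_compT (@fst_continuous _ _) cV.
    by move: i; apply/continuous_prodP.
- by move=> w; rewrite /= H0 K0.
- by move=> w; apply/funext => i; rewrite /= H1 K1 /= -surjective_pairing.
Qed.

End Product.

(** * Urysohn functions subordinate to a finite open cover *)

Section NormalCover.
Variables (R : realType) (T : topologicalType).
Hypothesis normalT : normal_space T.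

(* Induction on [k]: where a Urysohn function for the part of [C] covered by [U k]
   only is at most 1/2, [C] is covered by the first [k] sets. *)
Lemma normal_cover_functions (U : nat -> set T) (k : nat) (C : set T) :
  (forall i, open (U i)) -> closed C -> C `<=` \bigcup_(i < k) U i ->
  exists f : nat -> T -> R,
    [/\ forall i, continuous (f i), forall i z, 0 < f i z -> U i z &
      forall z, C z -> exists2 i, (i < k)%N & 2^-1 < f i z].
Proof.
move=> oU; elim: k C => [C _ C0|k IHk C clC CU].
  (* For [k = 0] the set [C] is empty, and zero functions meet the support condition at every
     index. *)
  exists (fun=> cst 0); split=> [i z|i z|z /C0 []]//; first exact: cvg_cst.
  by rewrite /= ltxx.
pose A := C `&` ~` (\bigcup_(i < k) U i).
have clA : closed A.
  by apply: closedI => //; apply: open_closedC; apply: bigcup_open => i _.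
have AU : ~` U k `&` A = set0.
  rewrite -subset0 => z [nUk [/CU [i /= ltik Uiz] nU]].
  move: ltik; rewrite ltnS leq_eqVlt => /predU1P[eik|ltik].
    by apply: nUk; rewrite -eik.
  by apply: nU; exists i.
have /(@uniform_separatorP _ R)[g [cg _ g0 g1]] :=
  iffLR (@normal_separatorP R T) normalT _ _ (open_closedC (oU k)) clA AU.
pose C' := C `&` [set z | g z <= 2^-1].
have [||f [cf fU fC]] := IHk C'.
- apply: closedI => //.
  exact: (preimage_closed (in1W cg) (@closed_le R 2^-1)).
- move=> z [Cz /= gz]; apply: contrapT => nU.
  have : g z = 1 by apply: (g1 (g z)); exists z.
  by move=> e; move: gz; rewrite e leNgt invf_lt1 ?ltr1n ?ltr0n.
(* The new function [g] takes slot [k]; all other slots keep the inductive functions, so the support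
   condition still holds at every natural index. *)
exists (fun i => if i == k then g else f i); split=> [i|i z|z Cz].
- by case: eqP.
- case: eqP => [-> gz|_]; last exact: fU.
  apply: contrapT => nU; have : g z = 0 by apply: (g0 (g z)); exists z.
  by move=> e; rewrite e ltxx in gz.
- have [gz|gz] := leP (g z) 2^-1; last by exists k; rewrite ?eqxx.
  have [//|i ltik fz] := fC z; exists i; first exact: ltnW.
  by rewrite ltn_eqF.
Qed.

End NormalCover.

(** * Running maxima and overlapping intervals *)

Section RunningMax.
Variables (R : realType) (T : topologicalType).
Implicit Type f : nat -> T -> R.

Fixpoint running_max f i (z : T) : R :=
  if i is i'.+1 then Num.max (running_max f i' z) (f i' z) else 0.

Lemma running_max_continuous f i :
  (forall i, continuous (f i)) -> continuous (running_max f i).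
Proof.
move=> cf; elim: i => [z|i IHi z]; first exact: cvg_cst.
by apply: continuous_max; [exact: IHi|exact: cf].
Qed.

Lemma running_max_le f i j z :
  (i <= j)%N -> running_max f i z <= running_max f j z.
Proof.
move/subnK <-; elim: (j - i)%N => //= m IHm.
by rewrite (le_trans IHm)// le_max lexx.
Qed.

(** Running maxima start at 0 and never decrease, so a jump at [i] forces [f i z] above a
    nonnegative number. *)
Lemma running_max_jump f i z :
  running_max f i z < running_max f i.+1 z -> 0 < f i z.
Proof.
rewrite /= lt_max ltxx /=; apply: le_lt_trans.
exact: (@running_max_le f 0).
Qed.

(** The running maximum starts at [0 <= c] and ends above [c], so it crosses the level [c] at some
    index. *)
Lemma running_max_first f k z (c : R) : 0 <= c ->
  (exists2 i, (i < k)%N & c < f i z) ->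
  exists i, [/\ (i < k)%N, running_max f i z <= c & c < running_max f i.+1 z].
Proof.
move=> c0; elim: k => [[]//|k IHk] [i ltik cf].
have [rk|rk] := leP (running_max f k z) c.
  exists k; split=> //; rewrite (lt_le_trans cf)//.
  by rewrite (le_trans _ (running_max_le _ _ ltik))//= le_max lexx orbT.
have [|j [ltjk ? ?]] := IHk; last by exists j; split=> //; exact: ltnW.
(* A running maximum above [c] exceeds its initial value 0, so one of the first [k] functions is
   above [c]. *)
elim: {IHk ltik} k rk => [|k IHk] /=; first by rewrite ltNge c0.
rewrite lt_max => /orP[/IHk [j ltjk ?]|ck].
  by exists j => //; exact: ltnW.
by exists k.
Qed.

(* The intervals (p_i, p_(i+1)) and (q_j, q_(j+1)) are nonempty and meet. *)
Definition overlap f g i j : set T :=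
  [set z | [/\ running_max f i z < running_max f i.+1 z,
      running_max g j z < running_max g j.+1 z,
      running_max f i z < running_max g j.+1 z &
      running_max g j z < running_max f i.+1 z]].

Lemma open_ltr (a b : T -> R) :
  continuous a -> continuous b -> open [set z | a z < b z].
Proof.
move=> ca cb; rewrite (_ : mkset _ = (b \- a) @^-1` [set x | 0 < x]).
  apply: open_comp; last exact: open_gt.
  by move=> z _; apply: cvgB; [exact: cb|exact: ca].
by apply/seteqP; split=> z /=; rewrite subr_gt0.
Qed.

Lemma open_overlap f g i j :
  (forall i, continuous (f i)) -> (forall j, continuous (g j)) ->
  open (overlap f g i j).
Proof.
move=> cf cg; rewrite (_ : overlap _ _ _ _ =
    [set z | running_max f i z < running_max f i.+1 z] `&`
    [set z | running_max g j z < running_max g j.+1 z] `&`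
    [set z | running_max f i z < running_max g j.+1 z] `&`
    [set z | running_max g j z < running_max f i.+1 z]).
  by do 3?apply: openI; apply: open_ltr; exact: running_max_continuous.
by apply/seteqP; split=> z /=; [case=> *; do !split|case=> [[[]]]].
Qed.

(** If [i < i'], then [j' < j], and the two overlaps give the contradiction [q_j < p_(i+1) <= p_(i')
    < q_(j'+1) <= q_j]. *)
Lemma overlap_antidiagonal f g i j i' j' z : (i + j = i' + j')%N ->
  overlap f g i j z -> overlap f g i' j' z -> (i, j) = (i', j').
Proof.
wlog ii' : i j i' j' / (i <= i')%N.
  move=> H e O1 O2; have [ii'|/ltnW ii'] := leqP i i'; first exact: H.
  by apply/esym; apply: (H).
move: ii'; rewrite leq_eqVlt => /predU1P[-> /addnI -> //|ltii'] e.
have ltj'j : (j' < j)%N by rewrite -(ltn_add2l i') -e ltn_add2r.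
move=> [_ _ _ ji] [_ _ ij' _].
have := lt_trans (lt_le_trans ji (running_max_le f z ltii')) ij'.
by rewrite ltNge running_max_le.
Qed.

(** The level [c] is crossed by both families: it lies in [[p_i, p_(i+1))] and in [[q_j, q_(j+1))],
    which makes these intervals overlap. *)
Lemma overlap_cover f g k l z (c : R) : 0 <= c ->
  (exists2 i, (i < k)%N & c < f i z) -> (exists2 j, (j < l)%N & c < g j z) ->
  exists i j, [/\ (i < k)%N, (j < l)%N & overlap f g i j z].
Proof.
move=> c0 /(running_max_first c0)[i [ltik fi fi1]].
move=> /(running_max_first c0)[j [ltjl gj gj1]].
exists i, j; split=> //.
by split; [exact: le_lt_trans fi fi1|exact: le_lt_trans gj gj1|
  exact: le_lt_trans fi gj1|exact: le_lt_trans gj fi1].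
Qed.

End RunningMax.

(** * The Schwarz genus as a minimum, and the product inequality *)

Lemma schwarz_genusP (R : realType) (E B : topologicalType) (p : E -> B) :
  schwarz_genus R p = +oo%E \/
  exists2 k, has_homotopy_section_cover R p k & schwarz_genus R p = k%:R%:E.
Proof.
have [[k0 pk0]|npk] := pselect (exists k, has_homotopy_section_cover R p k);
  last first.
  left; rewrite /schwarz_genus (_ : image _ _ = set0) ?ereal_inf0//.
  by rewrite -subset0 => x [k pk _]; apply: npk; exists k.
(* A nonempty set of natural numbers has a least element, so the infimum is attained. *)
have ex : exists k, `[< has_homotopy_section_cover R p k >].
  by exists k0; exact/asboolP.
right; case: (ex_minnP ex) => k /asboolP pk mink; exists k => //.
apply/le_anti/andP; split; first by apply: ereal_inf_lbound; exists k.
apply: le_ereal_inf_tmp => x [m pm <-].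
by rewrite lee_fin ler_nat mink//; exact/asboolP.
Qed.

Lemma has_homotopy_section_cover_TC_prod (R : realType) (X Y : topologicalType)
    (n k l : nat) :
  normal_space {ptws 'I_n -> (X * Y)%type} ->
  has_homotopy_section_cover R (@star_eval R n X) k ->
  has_homotopy_section_cover R (@star_eval R n Y) l ->
  has_homotopy_section_cover R (@star_eval R n (X * Y)%type) (k + l).
Proof.
move=> normalXY [U [oU coverU secU]] [V [oV coverV secV]].
pose Z : topologicalType := {ptws 'I_n -> (X * Y)%type}.
pose prX (z : Z) : {ptws 'I_n -> X} := fun i => (z i).1.
pose prY (z : Z) : {ptws 'I_n -> Y} := fun i => (z i).2.
have cZ i : continuous (fun z : Z => z i) by exact: (@proj_continuous _ _ i).
have cX : continuous prX.
  apply/continuous_prodP => i.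
  exact: continuous_compT (cZ i) (@fst_continuous _ _).
have cY : continuous prY.
  apply/continuous_prodP => i.
  exact: continuous_compT (cZ i) (@snd_continuous _ _).
(* [inord] extends the finite cover to all natural indices; on indices up to [k] it is the identity,
   so these still cover. *)
have [||f [cf fU f1]] := @normal_cover_functions R Z normalXY
    (fun i => prX @^-1` U (inord i)) k.+1 setT _ (@closedT _).
- by move=> i; apply: open_comp => // z _; exact: cX.
- move=> z _; have [i _ Ui] : (\bigcup_i U i) (prX z) by rewrite coverU.
  by exists (i : nat) => //=; rewrite inord_val.
have [||g [cg gV g1]] := @normal_cover_functions R Z normalXY
    (fun j => prY @^-1` V (inord j)) l.+1 setT _ (@closedT _).
- by move=> j; apply: open_comp => // z _; exact: cY.
- move=> z _; have [j _ Vj] : (\bigcup_j V j) (prY z) by rewrite coverV.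
  by exists (j : nat) => //=; rewrite inord_val.
(* The pairs range over all naturals with sum [m]: the support conditions [fU] and [gV] hold at
   every index, so each overlap set lies over some [U] and some [V]. *)
pose antidiag (m : nat) := {ij : nat * nat | ij.1 + ij.2 == m}%N.
pose W m (a : antidiag m) := overlap f g (val a).1 (val a).2.
exists (fun m : 'I_(k + l).+1 => \bigcup_a @W m a); split=> [m||m].
- by apply: bigcup_open => a _; exact: open_overlap.
- apply/seteqP; split=> // z _.
  have [|||i [j [ltik ltjl Oz]]] := @overlap_cover R Z f g k.+1 l.+1 z 2^-1.
  + by rewrite invr_ge0.
  + exact: f1.
  + exact: g1.
  (* From [i <= k] and [j <= l] the sum is at most [k + l], so [k + l + 1] antidiagonals suffice. *)
  have ltm : (i + j < (k + l).+1)%N by rewrite ltnS leq_add.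
  by exists (Ordinal ltm) => //; exists (exist _ (i, j) (eqxx _)).
apply: has_homotopy_section_bigcup => [a|a b z|].
- exact: open_overlap.
- case: a b => [[i j] /= ij] [[i' j'] /= ij'] Oz Oz'.
  apply: val_inj; apply: overlap_antidiagonal Oz Oz'.
  by rewrite (eqP ij) (eqP ij').
move=> [[i j] /= ij].
apply: (has_homotopy_section_prod _ _ (secU (inord i)) (secV (inord j))).
- by move=> z [/running_max_jump/fU].
- by move=> z [_ /running_max_jump/gV].
Qed.

Theorem proposition3p11 (R : realType) (X Y : topologicalType) (n : nat)
    (hX : path_connected_space R X) (hY : path_connected_space R Y)
    (hn : (2 <= n)%N)
    (hXYn_hausdorff : hausdorff_space {ptws 'I_n -> (X * Y)%type})
    (hXYn_normal : normal_space {ptws 'I_n -> (X * Y)%type}) :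
  (TC R n (X * Y)%type <= TC R n X + TC R n Y)%E.
Proof.
rewrite /TC.
(* If one genus is [+oo], so is the sum, since the other is [+oo] or a natural number and never
   [-oo]. *)
have [->|[k Uk ->]] := schwarz_genusP R (@star_eval R n X).
  have [->|[l _ ->]] := schwarz_genusP R (@star_eval R n Y);
    by rewrite addye// leey.
have [->|[l Vl ->]] := schwarz_genusP R (@star_eval R n Y).
  by rewrite addey// leey.
apply: ereal_inf_lbound; exists (k + l)%N; last by rewrite natrD.
exact: has_homotopy_section_cover_TC_prod.
Qed.
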